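(* Let $X$ and $Y$ be Banach spaces such that the projective tensor product $X\widehat{\otimes}_\pi Y$ has property (C) and $X$ has the $\lambda$-BSAP for some $\lambda\geq 1$. The following statements hold: (a) Every element of $\mathcal{L}(X,Y^* )$ has $w^*$-separable range. (b) $\mathcal{W}(X,Y^* )\subseteq \mathcal{S}(X,Y^* )$. (c) If $\lambda=1$, then $\mathcal{L}(X,Y^* )=\mathcal{W^*S}(X,Y^* )$.
   Context: All Banach spaces are real; an operator is a continuous linear map; $B_X$ is the closed unit ball of $X$; $w^*$ denotes the weak$^*$ topology. A Banach space $Z$ has (Corson's) property (C) if every family of convex closed subsets of $Z$ with empty intersection has a countable subfamily with empty intersection. For Banach spaces $X,Z$: $\mathcal{L}(X,Z)$ is the Banach space of all operators from $X$ to $Z$ (and $\mathcal{L}(Z)=\mathcal{L}(Z,Z)$), $\mathcal{W}(X,Z)$ is the set of weakly compact operators, $\mathcal{S}(X,Z)$ is the set of operators with (norm) separable range (and $\mathcal{S}(Z)=\mathcal{S}(Z,Z)$). $\mathcal{W^*S}(X,Y^* )$ denotes the set of all $T\in\mathcal{L}(X,Y^* )$ such that $T(B_X)$ is $w^*$-separable. ''$T$ has $w^*$-separable range'' means that $T(X)$ is separable in the topology $w^*$ of $Y^*$. A Banach space $Z$ has the $\lambda$-bounded separable approximation property ($\lambda$-BSAP), $\lambda\ge 1$, if the identity operator on $Z$ belongs to the closure of $\lambda B_{\mathcal{L}(Z)}\cap\mathcal{S}(Z)$ in the strong operator topology (the topology of pointwise norm convergence on $Z$). *)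

(* Defs.v *)
From HB Require Import structures.
From mathcomp Require Import all_boot all_order all_algebra.
From mathcomp Require Import sesquilinear generic_quotient ring_quotient.
From mathcomp Require Import all_classical all_reals all_analysis.

Set Implicit Arguments.
Unset Strict Implicit.
Unset Printing Implicit Defensive.

Import Order.TTheory GRing.Theory Num.Theory.
Import numFieldNormedType.Exports.

Local Open Scope classical_set_scope.
Local Open Scope ring_scope.

Definition unit_ball (R : realType) (X : normedModType R) : set X :=
  [set x | `|x| <= 1].
Arguments unit_ball {R} X.

Section Operators.
Context (R : realType) (X Z : normedModType R).

Definition is_operator : {pred (X -> Z)} :=
  fun f => `[< linear f /\ continuous f >].

Record operator := Operator {
  operator_fun :> X -> Z;
  operator_funP : operator_fun \in is_operator }.

HB.instance Definition _ := [isSub for operator_fun].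
HB.instance Definition _ := [Choice of operator by <:].

Fact is_operator_submod_closed : submod_closed is_operator.
Proof.
split=> [|a f g /asboolP[fl fc] /asboolP[gl gc]]; apply/asboolP; split.
- by move=> k x y; rewrite scaler0 addr0.
- exact: cst_continuous.
- move=> k x y; rewrite !fctE /= fl gl !scalerDr !scalerA.
  by rewrite [k * a]mulrC addrACA.
- move=> x; apply: continuousD; last exact: gc.
  exact/continuousZl_tmp/fc.
Qed.

HB.instance Definition _ :=
  GRing.isSubmodClosed.Build R (X -> Z) is_operator is_operator_submod_closed.
HB.instance Definition _ := [SubChoice_isSubLmodule of operator by <:].

Implicit Types T : operator.

Fact operator_linear T : linear T.
Proof. by case: T => f /= /asboolP[]. Qed.

HB.instance Definition _ T := GRing.isLinear.Build R X Z _ T (operator_linear T).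

Lemma operator_continuous T : continuous T.
Proof. by case: T => f /= /asboolP[]. Qed.

Lemma operatorP T1 T2 : (forall x, T1 x = T2 x) -> T1 = T2.
Proof. by move=> eqT; apply/val_inj/funext. Qed.

Lemma operator0E x : (0 : operator) x = 0.
Proof. by []. Qed.

Lemma operatorDE T1 T2 x : (T1 + T2) x = T1 x + T2 x.
Proof. by []. Qed.

Lemma operatorZE a T x : (a *: T) x = a *: T x.
Proof. by []. Qed.

Definition opnorm T : R := sup [set `|T x| | x in unit_ball X].

Fact opnorm_has_sup T : has_sup [set `|T x| | x in unit_ball X].
Proof.
split; first by exists `|T 0|, 0 => //; rewrite /unit_ball/= normr0.
have /linear_boundedP/pinfty_ex_gt0[M M0 TM] :=
  continuous_linear_bounded 0 (@operator_continuous T 0).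
exists M => _ [x x1 <-]; apply: le_trans (TM x) _.
by rewrite ler_piMr// ltW.
Qed.

Lemma opnorm_ub T x : `|x| <= 1 -> `|T x| <= opnorm T.
Proof. by move=> x1; apply: (sup_upper_bound (opnorm_has_sup T)); exists x. Qed.

Lemma opnorm_le T M : (forall x, `|x| <= 1 -> `|T x| <= M) -> opnorm T <= M.
Proof.
move=> TM; apply: ge_sup; first by case: (opnorm_has_sup T).
by move=> _ [x x1 <-]; exact: TM.
Qed.

Lemma opnorm_bound T x : `|T x| <= opnorm T * `|x|.
Proof.
have [->|x0] := eqVneq x 0; first by rewrite linear0 !normr0 mulr0.
rewrite -ler_pdivrMr ?normr_gt0// mulrC -[_^-1]gtr0_norm ?invr_gt0 ?normr_gt0//.
rewrite -normrZ -linearZ; apply: opnorm_ub.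
by rewrite normrZ gtr0_norm ?invr_gt0 ?normr_gt0// mulVf ?normr_eq0.
Qed.

Fact opnorm_triangle T1 T2 : opnorm (T1 + T2) <= opnorm T1 + opnorm T2.
Proof.
apply: opnorm_le => x x1; rewrite operatorDE (le_trans (ler_normD _ _))//.
by rewrite lerD// opnorm_ub.
Qed.

Fact opnormZ a T : opnorm (a *: T) = `|a| * opnorm T.
Proof.
have le_opnormZ b S : opnorm (b *: S) <= `|b| * opnorm S.
  by apply: opnorm_le => x x1; rewrite operatorZE normrZ ler_wpM2l// opnorm_ub.
apply/eqP; rewrite eq_le le_opnormZ/=.
have [->|a0] := eqVneq a 0.
  rewrite normr0 mul0r scale0r -[leLHS](normr0 Z) -(operator0E 0).
  by apply: opnorm_ub; rewrite normr0.
rewrite -ler_pdivlMl ?normr_gt0// -normfV.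
by rewrite -[X in opnorm X <= _](scalerK a0) le_opnormZ.
Qed.

Fact opnorm0_eq0 T : opnorm T = 0 -> T = 0.
Proof.
move=> T0; apply: operatorP => x; apply/normr0_eq0/le_anti.
by rewrite normr_ge0 andbT (le_trans (opnorm_bound T x))// T0 mul0r.
Qed.

HB.instance Definition _ :=
  Lmodule_isNormed.Build R operator opnorm_triangle opnormZ opnorm0_eq0.

End Operators.

Section IdOperator.
Context (R : realType) (X : normedModType R).

Fact id_is_operator : (id : X -> X) \in @is_operator R X X.
Proof. by apply/asboolP; split=> [//|x]; exact: cvg_id. Qed.

Definition id_operator : operator X X := Operator id_is_operator.

End IdOperator.
Arguments id_operator {R} X.

Definition dual (R : realType) (X : normedModType R) : normedModType R :=
  operator X R^o.

(* The weak, weak* and strong operator topologies are the initial topologies for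
   the evaluations, i.e., pulled back from the topology of pointwise convergence
   {ptws _ -> _}. As types, weak Z, weak_star Y and sot X Z are Z, dual Y and
   operator X Z: in [A : set (weak_star Y)] the cast selects the topology. *)
Definition weak (R : realType) (Z : normedModType R) : topologicalType :=
  initial_topology (fun z : Z => (fun phi => phi z) : {ptws dual Z -> R}).

Definition weak_star (R : realType) (Y : normedModType R) : topologicalType :=
  initial_topology (fun phi : dual Y => (phi : Y -> R) : {ptws Y -> R}).

Definition sot (R : realType) (X Z : normedModType R) : topologicalType :=
  initial_topology (fun T : operator X Z => (T : X -> Z) : {ptws X -> Z}).

(* Separability of the subspace A of T: the countable set must lie in A. *)
Definition separable_set (T : topologicalType) (A : set T) :=
  exists D : set T, [/\ countable D, D `<=` A & A `<=` closure D].

Section OperatorClasses.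
Context (R : realType).

Definition weakly_compact_operators (X Z : normedModType R) :
    set (operator X Z) :=
  [set T | compact (closure (T @` unit_ball X : set (weak Z)))].

Definition separable_operators (X Z : normedModType R) : set (operator X Z) :=
  [set T | separable_set (range T)].

Definition weak_star_separable_operators (X Y : normedModType R) :
    set (operator X (dual Y)) :=
  [set T | separable_set (T @` unit_ball X : set (weak_star Y))].

Definition has_weak_star_separable_range (X Y : normedModType R)
    (T : operator X (dual Y)) :=
  separable_set (range T : set (weak_star Y)).

End OperatorClasses.
Arguments weakly_compact_operators {R} X Z.
Arguments separable_operators {R} X Z.
Arguments weak_star_separable_operators {R} X Y.

Definition BSAP (R : realType) (lambda : R) (Z : normedModType R) :=
  closure ([set lambda *: T | T in unit_ball (operator Z Z)]
             `&` separable_operators Z Z : set (sot Z Z)) (id_operator Z).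

Definition property_C (R : realType) (Z : normedModType R) :=
  forall F : set (set Z), (forall C, F C -> convex_set C /\ closed C) ->
    \bigcap_(C in F) C = set0 ->
  exists G : set (set Z),
    [/\ G `<=` F, countable G & \bigcap_(C in G) C = set0].

Record seminorm (R : realType) (V : lmodType R) := Seminorm {
  seminorm_fun :> V -> R;
  seminormD : forall u v, seminorm_fun (u + v) <= seminorm_fun u + seminorm_fun v;
  seminormZ : forall a v, seminorm_fun (a *: v) = `|a| * seminorm_fun v }.

Section Completion.
Context (R : realType) (V : lmodType R) (p : seminorm V).

Lemma seminorm0 : p 0 = 0.
Proof. by rewrite -(scale0r 0) seminormZ normr0 mul0r. Qed.

Lemma seminormN v : p (- v) = p v.
Proof. by rewrite -scaleN1r seminormZ normrN normr1 mul1r. Qed.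

Lemma seminorm_ge0 v : 0 <= p v.
Proof.
rewrite -(pmulrn_lge0 _ (isT : (0 < 2)%N)) mulr2n -[X in _ + X]seminormN.
by rewrite -seminorm0 -(subrr v) seminormD.
Qed.

Lemma seminormB_ge u v : `|p u - p v| <= p (u - v).
Proof.
rewrite ler_norml lerBlDr -[X in p X <= _](subrK v) seminormD andbT.
by rewrite lerNl opprB lerBlDr -(seminormN (u - v)) opprB -[X in p X <= _](subrK u) seminormD.
Qed.

(* The completion of V for p: Cauchy sequences modulo null sequences, with
   the norm lim p(u_n); elements of p-seminorm 0 are identified with 0. *)
Definition is_cauchy_seq : {pred (nat -> V)} := fun u => `[< forall e, 0 < e ->
  exists N, forall m n, (N <= m)%N -> (N <= n)%N -> p (u m - u n) < e >].

Record cauchy_seq := CauchySeq {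
  cauchy_seq_fun :> nat -> V;
  cauchy_seqP : cauchy_seq_fun \in is_cauchy_seq }.

HB.instance Definition _ := [isSub for cauchy_seq_fun].
HB.instance Definition _ := [Choice of cauchy_seq by <:].

Fact is_cauchy_seq_submod_closed : submod_closed is_cauchy_seq.
Proof.
split=> [|a u v /asboolP uc /asboolP vc]; apply/asboolP => e e0.
  by exists 0%N => m n _ _; rewrite subrr seminorm0.
have a0 : 0 < `|a| + 1 by rewrite ltr_wpDl.
have [N uN] := uc (e / 2 / (`|a| + 1)) ltac:(by rewrite !divr_gt0).
have [M vM] := vc (e / 2) ltac:(by rewrite divr_gt0).
exists (maxn N M) => m n; rewrite !geq_max => /andP[Nm Mm] /andP[Nn Mn].
rewrite !fctE opprD addrACA -scalerBr (le_lt_trans (seminormD _ _ _))//.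
rewrite [ltRHS]splitr ltr_leD//; last exact/ltW/vM.
rewrite seminormZ (@le_lt_trans _ _ ((`|a| + 1) * p (u m - u n)))//.
  by rewrite ler_wpM2r ?seminorm_ge0// lerDl.
by rewrite mulrC -ltr_pdivlMr// uN.
Qed.

HB.instance Definition _ := GRing.isSubmodClosed.Build R (nat -> V)
  is_cauchy_seq is_cauchy_seq_submod_closed.
HB.instance Definition _ := [SubChoice_isSubLmodule of cauchy_seq by <:].

Definition is_null_seq : {pred cauchy_seq} :=
  fun u => `[< p (u n) @[n --> \oo] --> (0 : R) >].

Fact is_null_seqZD a (u v : cauchy_seq) :
  u \in is_null_seq -> v \in is_null_seq -> a *: u + v \in is_null_seq.
Proof.
move=> /asboolP u0 /asboolP v0; apply/asboolP.
have uv0 : `|a| * p (u n) + p (v n) @[n --> \oo] --> (0 : R).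
  by rewrite -[X in _ --> X]addr0 -[X in _ --> X + _](mulr0 `|a|);
    apply: cvgD v0; exact: cvgMr.
apply: squeeze_cvgr (cvg_cst 0) uv0; apply: nearW => n.
by rewrite seminorm_ge0/= -seminormZ seminormD.
Qed.

Fact is_null_seq_zmod_closed : zmod_closed is_null_seq.
Proof.
split=> [|u v u0 v0].
  apply/asboolP; rewrite (_ : (fun _ => _) = cst 0) ?funeqE; first exact: cvg_cst.
  by move=> n; rewrite seminorm0.
by rewrite -scaleN1r addrC is_null_seqZD.
Qed.

HB.instance Definition _ :=
  GRing.isZmodClosed.Build cauchy_seq is_null_seq is_null_seq_zmod_closed.

Definition completion := Quotient.quot is_null_seq.


HB.instance Definition _ := GRing.Zmodule.on completion.

Definition to_completion (u : cauchy_seq) : completion := (\pi_(completion) u)%qT.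

Lemma to_completion_surj x : exists u, x = to_completion u.
Proof. by exists (repr x); rewrite /to_completion reprK. Qed.

Lemma to_completion_eq u v :
  to_completion u = to_completion v <-> u - v \in is_null_seq.
Proof. by rewrite Quotient.idealrBE; split => /eqP. Qed.

Lemma to_completionD u v :
  to_completion (u + v) = to_completion u + to_completion v.
Proof. by rewrite /to_completion !piE. Qed.

Definition completion_scale (a : R) (x : completion) : completion :=
  to_completion (a *: repr x).

Lemma to_completionZ a u :
  to_completion (a *: u) = completion_scale a (to_completion u).
Proof.
apply/to_completion_eq; rewrite -scalerBr -[_ *: _]addr0.
apply: is_null_seqZD; last exact: (rpred0 is_null_seq).
by apply/to_completion_eq; rewrite /to_completion reprK.
Qed.

Fact completion_scaleA a b x :
  completion_scale a (completion_scale b x) = completion_scale (a * b) x.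
Proof. by have [u ->] := to_completion_surj x; rewrite -!to_completionZ scalerA. Qed.

Fact completion_scale1 : left_id 1 completion_scale.
Proof. by move=> x; have [u ->] := to_completion_surj x; rewrite -to_completionZ scale1r. Qed.

Fact completion_scaleDr : right_distributive completion_scale +%R.
Proof.
move=> a x y; have [u ->] := to_completion_surj x; have [v ->] := to_completion_surj y.
by rewrite -to_completionD -!to_completionZ scalerDr to_completionD.
Qed.

Fact completion_scaleDl x : {morph completion_scale^~ x : a b / a + b}.
Proof.
move=> a b; have [u ->] := to_completion_surj x.
by rewrite -!to_completionZ scalerDl to_completionD.
Qed.

HB.instance Definition _ := GRing.Zmodule_isLmodule.Build R completion
  completion_scaleA completion_scale1 completion_scaleDr completion_scaleDl.

Fact to_completion_linear : linear to_completion.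
Proof. by move=> a u v; rewrite to_completionD to_completionZ. Qed.

HB.instance Definition _ := GRing.isLinear.Build R cauchy_seq completion _
  to_completion to_completion_linear.

Definition completion_norm (x : completion) : R :=
  limn (fun n => p ((repr x : cauchy_seq) n)).

Fact cauchy_seq_cvg (u : cauchy_seq) : cvgn (fun n => p (u n)).
Proof.
apply/cauchy_cvgP/cauchy_exP => e e0; have /asboolP/(_ e e0)[N uN] := cauchy_seqP u.
exists (p (u N)); exists N => // n /= Nn.
by rewrite /ball/= (le_lt_trans (seminormB_ge _ _))// uN.
Qed.

Lemma to_completion_norm u :
  completion_norm (to_completion u) = limn (fun n => p (u n)).
Proof.
rewrite /completion_norm; set v := repr _.
have /to_completion_eq/asboolP vu : to_completion v = to_completion u.
  by rewrite [LHS]reprK.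
apply/cvg_lim => //.
suff : p (v n) - p (u n) @[n --> \oo] --> (0 : R).
  move/cvgD/(_ (@cauchy_seq_cvg u)); rewrite add0r.
  by apply: cvg_trans; apply: near_eq_cvg; apply: nearW => n; rewrite fctE subrK.
apply: norm_cvg0; apply: squeeze_cvgr (cvg_cst 0) vu.
by apply: nearW => n; rewrite normr_ge0 seminormB_ge.
Qed.

Fact completion_normD x y :
  completion_norm (x + y) <= completion_norm x + completion_norm y.
Proof.
have [u ->] := to_completion_surj x; have [v ->] := to_completion_surj y.
rewrite -to_completionD !to_completion_norm -limD; try exact: cauchy_seq_cvg.
apply: ler_lim; first exact: cauchy_seq_cvg.
  by apply: is_cvgD; exact: cauchy_seq_cvg.
by apply: nearW => n; rewrite seminormD.
Qed.

Fact completion_normZ a x : completion_norm (a *: x) = `|a| * completion_norm x.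
Proof.
have [u ->] := to_completion_surj x; rewrite -linearZ !to_completion_norm.
apply: cvg_lim => //; under eq_fun do rewrite seminormZ.
by apply: cvgMr; exact: cauchy_seq_cvg.
Qed.

Fact completion_norm0_eq0 x : completion_norm x = 0 -> x = 0.
Proof.
have [u ->] := to_completion_surj x; rewrite to_completion_norm => u0.
rewrite -(linear0 to_completion); apply/to_completion_eq; rewrite subr0.
by apply/asboolP; rewrite -u0; exact: cauchy_seq_cvg.
Qed.

HB.instance Definition _ := Lmodule_isNormed.Build R completion
  completion_normD completion_normZ completion_norm0_eq0.

Fact cst_is_cauchy_seq v : (fun _ : nat => v) \in is_cauchy_seq.
Proof. by apply/asboolP => e e0; exists 0%N => m n _ _; rewrite subrr seminorm0. Qed.

Definition completion_embed v : completion :=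
  to_completion (CauchySeq (cst_is_cauchy_seq v)).

Fact completion_embed_linear : linear completion_embed.
Proof.
move=> a u v; rewrite /completion_embed -linearP.
by apply: (congr1 to_completion); exact/val_inj.
Qed.

HB.instance Definition _ := GRing.isLinear.Build R V completion _
  completion_embed completion_embed_linear.

Lemma completion_embed_norm v : `|completion_embed v| = p v.
Proof.
rewrite [LHS]to_completion_norm; apply: cvg_lim; first exact: Rhausdorff.
by rewrite /=; exact: cvg_cst.
Qed.

Lemma to_completion_cvg (u : cauchy_seq) :
  completion_embed (u n) @[n --> \oo] --> to_completion u.
Proof.
apply/cvgrPdist_le => e e0; have /asboolP/(_ e e0)[N uN] := cauchy_seqP u.
exists N => // n /= Nn; rewrite -linearB [leLHS]to_completion_norm.
apply: limr_le; first exact: cauchy_seq_cvg.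
by exists N => // m /= Nm; exact/ltW/uN.
Qed.

Lemma completion_embed_dense : closure (range completion_embed) = setT.
Proof.
rewrite -subTset => x _ B Bx; have [u xE] := to_completion_surj x.
have := @to_completion_cvg u B; rewrite -xE => /(_ Bx)[N _ uB].
by exists (completion_embed (u N)); split; [exists (u N)|exact: (uB N (leqnn N))].
Qed.

Fact completion_complete (F : set_system completion) :
  ProperFilter F -> cauchy F -> cvg F.
Proof.
move=> FF /cauchyP Fc.
have /choice[v vF] (n : nat) : exists v, F (ball (completion_embed v) n.+1%:R^-1).
  have /Fc[x Fx] : 0 < n.+1%:R^-1 / 2 :> R by rewrite divr_gt0// invr_gt0.
  have : closure (range completion_embed) x by rewrite completion_embed_dense.
  move=> /(_ (ball x (n.+1%:R^-1 / 2)))[|_ [[v _ <-] xv]].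
    by apply: nbhsx_ballx; rewrite divr_gt0// invr_gt0.
  exists v; apply: filterS Fx => y xy; rewrite [X in ball _ X](splitr _).
  exact: ball_triangle (ball_sym xv) xy.
have vc : v \in is_cauchy_seq.
  apply/asboolP => e e0; have := near_infty_natSinv_lt (PosNum (divr_gt0 e0 (ltr0n _ 2))).
  move=> [N _ eN]; exists N => m n Nm Nn; rewrite -completion_embed_norm linearB.
  have [y [my ny]] := filter_ex (filterI (vF m) (vF n)).
  have := ball_triangle my (ball_sym ny).
  rewrite -ball_normE /ball_/= => /lt_trans; apply.
  by rewrite [ltRHS]splitr ltrD// eN.
apply/cvg_ex; exists (to_completion (CauchySeq vc)).
apply/cvgrPdist_lt => e e0; have e20 : 0 < e / 2 by rewrite divr_gt0.
have /cvgrPdist_lt/(_ _ e20)[N _ vN] := @to_completion_cvg (CauchySeq vc).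
have [M _ eM] := near_infty_natSinv_lt (PosNum e20).
apply: filterS (vF (maxn N M)) => y vy.
rewrite [ltRHS]splitr -[_ - y](subrKA (completion_embed (v (maxn N M)))).
rewrite (le_lt_trans (ler_normD _ _))// ltrD//.
  by apply: vN; rewrite /= leq_maxl.
move: vy; rewrite -ball_normE /ball_/= => /lt_trans; apply.
by apply: eM; rewrite /= leq_maxr.
Qed.

HB.instance Definition _ := Uniform_isComplete.Build completion completion_complete.

End Completion.

Section AlgebraicTensor.
Context (R : realType) (X Y : lmodType R).

(* The algebraic tensor product is the linear span of the functionals
   x (x) y : B |-> B x y on the space of bilinear forms on X * Y. A finite sum
   of a_i (x_i (x) y_i) is also one of (a_i x_i) (x) y_i, so scalars are not
   needed in is_tensor. *)
Local Notation dual_bilinear := ({bilinear X -> Y -> R^o} -> R^o).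

Definition eval_bilinear (x : X) (y : Y) : dual_bilinear := fun B => B x y.

Definition is_tensor : {pred dual_bilinear} := fun u =>
  `[< exists s : seq (X * Y), u = \sum_(p <- s) eval_bilinear p.1 p.2 >].

Record tensor := Tensor {
  tensor_val : dual_bilinear;
  tensor_valP : tensor_val \in is_tensor }.

HB.instance Definition _ := [isSub for tensor_val].
HB.instance Definition _ := [Choice of tensor by <:].

Fact eval_bilinearZ a x y : eval_bilinear (a *: x) y = a *: eval_bilinear x y.
Proof. by apply/funext => B; rewrite /eval_bilinear linearZl_LR. Qed.

Fact is_tensor_submod_closed : submod_closed is_tensor.
Proof.
split=> [|a u v /asboolP[s ->] /asboolP[t ->]]; apply/asboolP.
  by exists [::]; rewrite big_nil.
exists ([seq (a *: p.1, p.2) | p <- s] ++ t).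
rewrite big_cat big_map scaler_sumr; congr (_ + _).
by apply: eq_bigr => p _; rewrite eval_bilinearZ.
Qed.

HB.instance Definition _ := GRing.isSubmodClosed.Build R dual_bilinear
  is_tensor is_tensor_submod_closed.
HB.instance Definition _ := [SubChoice_isSubLmodule of tensor by <:].

Fact eval_bilinear_is_tensor x y : eval_bilinear x y \in is_tensor.
Proof. by apply/asboolP; exists [:: (x, y)]; rewrite big_seq1. Qed.

Definition pure_tensor x y : tensor := Tensor (eval_bilinear_is_tensor x y).

Lemma tensorP (u : tensor) :
  exists s : seq (X * Y), u = \sum_(p <- s) pure_tensor p.1 p.2.
Proof.
case: u => u uP; have /asboolP[s us] := uP; exists s; apply/val_inj.
by rewrite raddf_sum /= us.
Qed.

Lemma pure_tensor_bilinear : bilinear_for *:%R *:%R pure_tensor.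
Proof.
split=> [y a x1 x2|x a y1 y2]; apply/val_inj/funext => B /=.
  by rewrite /eval_bilinear linearPl.
by rewrite /eval_bilinear linearPr.
Qed.

HB.instance Definition _ :=
  bilinear_isBilinear.Build R X Y tensor _ _ pure_tensor pure_tensor_bilinear.

End AlgebraicTensor.

Section ProjectiveTensor.
Context (R : realType) (X Y : normedModType R).

Definition projective_norm (u : tensor X Y) : R :=
  inf [set \sum_(p <- s) `|p.1| * `|p.2| | s in
       [set s : seq (X * Y) | u = \sum_(p <- s) pure_tensor p.1 p.2]].

Fact projective_norm_has_inf u :
  has_inf [set \sum_(p <- s) `|p.1| * `|p.2| | s in
    [set s : seq (X * Y) | u = \sum_(p <- s) pure_tensor p.1 p.2]].
Proof.
split; first by have [s us] := tensorP u; eexists; exists s.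
by exists 0 => _ [s _ <-]; apply: sumr_ge0 => p _; rewrite mulr_ge0.
Qed.

Lemma projective_norm_le s :
  projective_norm (\sum_(p <- s) pure_tensor p.1 p.2) <=
  \sum_(p <- s) `|p.1| * `|p.2|.
Proof. by apply: ge_inf; [case: (projective_norm_has_inf (\sum_(p <- s) pure_tensor p.1 p.2))|exists s]. Qed.

Lemma projective_norm_lt u e : 0 < e ->
  exists2 s, u = \sum_(p <- s) pure_tensor p.1 p.2 &
    \sum_(p <- s) `|p.1| * `|p.2| < projective_norm u + e.
Proof.
move=> e0; have [_ [s us <-] se] := inf_adherent e0 (projective_norm_has_inf u).
by exists s.
Qed.

Fact projective_normD u v :
  projective_norm (u + v) <= projective_norm u + projective_norm v.
Proof.
apply/ler_addgt0Pr => e e0; have e20 : 0 < e / 2 by rewrite divr_gt0.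
have [s us se] := projective_norm_lt u e20.
have [t vt te] := projective_norm_lt v e20.
rewrite [in leLHS]us [in leLHS]vt -big_cat (le_trans (projective_norm_le _))//.
by rewrite big_cat/= [e]splitr addrACA lerD// ltW.
Qed.

Fact projective_normZ a u : projective_norm (a *: u) = `|a| * projective_norm u.
Proof.
have leZ b v : projective_norm (b *: v) <= `|b| * projective_norm v.
  apply/ler_addgt0Pr => e e0; have b0 : 0 < `|b| + 1 by rewrite ltr_wpDl.
  have [s vs se] := projective_norm_lt v (divr_gt0 e0 b0).
  have -> : b *: v =
      \sum_(p <- [seq (b *: q.1, q.2) | q <- s]) pure_tensor p.1 p.2.
    by rewrite big_map vs scaler_sumr; apply: eq_bigr => p _; rewrite linearZl_LR.
  rewrite (le_trans (projective_norm_le _))// big_map.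
  under eq_bigr do rewrite /= normrZ -mulrA.
  rewrite -mulr_sumr (le_trans (ler_wpM2l _ (ltW se)))// mulrDr lerD2l.
  by rewrite mulrCA ler_piMr// ?(ltW e0)// ler_pdivrMr// mul1r lerDl.
apply/eqP; rewrite eq_le leZ/=; have [->|a0] := eqVneq a 0.
  rewrite normr0 mul0r; apply: lb_le_inf; first by case: (projective_norm_has_inf (0 *: u)).
  by move=> _ [s _ <-]; apply: sumr_ge0 => p _; rewrite mulr_ge0.
by rewrite -ler_pdivlMl ?normr_gt0// -normfV -[X in projective_norm X <= _](scalerK a0) leZ.
Qed.

Definition projective_seminorm : seminorm (tensor X Y) :=
  Seminorm projective_normD projective_normZ.

Definition projective_tensor : completeNormedModType R :=
  completion projective_seminorm.

End ProjectiveTensor.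

(* Main.v *)
Require Import Defs.
From HB Require Import structures.
From mathcomp Require Import all_boot all_order all_algebra.
From mathcomp Require Import all_classical all_reals all_analysis.
From mathcomp Require Import ring lra.

Import Order.TTheory GRing.Theory Num.Theory.
Import numFieldNormedType.Exports.

Local Open Scope classical_set_scope.
Local Open Scope ring_scope.

(* Operators U : X -> Y* act on the projective tensor product by
   x (x) y |-> (U x) y, and by the approximation property T is the weak* limit
   of operators T o S, where S has separable range and norm at most lambda.
   Property (C), in Pol's dual form, makes T a weak* limit of convex
   combinations of countably many T o S_n. Hence there is a countable set D in
   the unit ball of X such that T x is in the weak* closure of T(D) whenever
   lambda |x| <= 1. This is (c) when lambda = 1, and (a) follows by scaling. If
   T is weakly compact then the weak* and weak topologies agree on the closure
   of T(D), and by Hahn-Banach the weak closure of a subspace is its norm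
   closure, whence (b). *)

(** * Neighbourhoods and closures in topologies of pointwise convergence *)

Section PointwiseTopology.
Context {R : realType} {S : choiceType} {U : topologicalType}
  {V : normedModType R} (f : S -> {ptws U -> V}).
Local Notation W := (initial_topology f).

Definition pointwise_ball (p : S) (s : seq U) (e : R) : set S :=
  [set q | forall u, u \in s -> `|f p u - f q u| < e].

Lemma eval_initial_continuous (u : U) : continuous (fun q : W => f q u).
Proof.
move=> p; have FF : Filter (f @ nbhs (p : W)) by exact: fmap_filter.
have := @initial_continuous S {ptws U -> V} f p.
by move=> /(pointwise_cvgP _ FF)/(_ u).
Qed.

Lemma nbhs_pointwise_ball (p : S) s e : 0 < e ->
  nbhs (p : W) (pointwise_ball p s e).
Proof.
move=> e0; elim: s => [|u s IHs]; first exact: filterS filterT.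
have up : nbhs (p : W) [set q | `|f p u - f q u| < e].
  by have /cvgrPdist_lt/(_ e e0) := @eval_initial_continuous u p.
apply: filterS2 up IHs => q uq sq v; rewrite inE => /predU1P[->//|]; exact: sq.
Qed.

(** The balls around [p] form a filter base along which every evaluation converges to its value at
    [p]. So [f] converges pointwise along it, and each neighbourhood contains a ball. *)
Lemma pointwise_ball_nbhs (p : S) (A : set W) : nbhs (p : W) A ->
  exists s, exists2 e, 0 < e & pointwise_ball p s e `<=` A.
Proof.
pose F := filter_from [set i : seq U * R | 0 < i.2]
  (fun i => pointwise_ball p i.1 i.2).
have FF : Filter F.
  apply: filter_from_filter; first by exists ([::], 1) => /=.
  move=> [s e] [t d] /= e0 d0; exists (s ++ t, Num.min e d).
    by rewrite /= lt_min e0.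
  move=> q /= pq; split => u us.
    by have := pq u; rewrite mem_cat us lt_min => /(_ isT)/andP[].
  by have := pq u; rewrite mem_cat us orbT lt_min => /(_ isT)/andP[].
have FfF : Filter (f @ F) by exact: fmap_filter.
have fF : {ptws, f @ F --> f p}.
  apply/(pointwise_cvgP _ FfF) => u; apply/cvgrPdist_lt => e e0.
  by exists ([:: u], e) => //= q; apply; rewrite inE.
rewrite nbhsE => -[_ [[B Bo <-] Bp] BA].
have [|[s e] /= e0 seB] := fF B; first exact: open_nbhs_nbhs.
by exists s, e => // q /seB; exact: BA.
Qed.

Lemma closure_pointwiseP (A : set W) (p : W) :
  closure A p <->
  forall s e, 0 < e -> exists2 q, A q & pointwise_ball p s e q.
Proof.
split=> [Ap s e e0|Ap B /pointwise_ball_nbhs[s [e e0 seB]]].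
  by have [q [Aq pq]] := Ap _ (@nbhs_pointwise_ball p s e e0); exists q.
by have [q Aq /seB] := Ap s e e0; exists q.
Qed.

End PointwiseTopology.

(** * Sublinear functionals, Hahn-Banach and separation from a subspace *)

Section HahnBanach.
Context {R : realType} {V : lmodType R}.
Implicit Types (q : V -> R) (p x y z : V).

Definition sublinear q := (forall x y, q (x + y) <= q x + q y) /\
  (forall (a : R) x, 0 <= a -> q (a *: x) = a * q x).

Lemma sublinear0 q : sublinear q -> q 0 = 0.
Proof. by move=> [_ qZ]; rewrite -(scale0r 0) qZ// mul0r. Qed.

Lemma sublinear_ge q x : sublinear q -> - q (- x) <= q x.
Proof.
move=> ql; rewrite -subr_ge0 opprK -(sublinear0 _ ql) -(subrr x).
by case: ql => + _; apply.
Qed.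

(** The index [k] may depend on the arguments, so that one lemma covers infima over shifts, over
    chains and over distances to a subspace. *)
Lemma inf_sublinear {I : Type} (D : set I) (g : I -> V -> R) :
  (forall z, exists m, forall i, D i -> m <= g i z) ->
  (forall i j x y, D i -> D j ->
    exists2 k, D k & g k (x + y) <= g i x + g j y) ->
  (forall i a x, D i -> 0 < a -> exists2 k, D k & g k (a *: x) <= a * g i x) ->
  (forall i, D i -> 0 <= g i 0) -> (exists2 i, D i & g i 0 <= 0) ->
  sublinear (fun z => inf [set g i z | i in D]).
Proof.
move=> glb gD gZ g0 [i0 Di0 gi0].
have hi z : has_inf [set g i z | i in D].
  split; first by exists (g i0 z), i0.
  by have [m mg] := glb z; exists m => _ [i Di <-]; exact: mg.
have infle i z : D i -> inf [set g i z | i in D] <= g i z.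
  by move=> Di; apply: ge_inf; [case: (hi z)|exists i].
have inflt z e : 0 < e -> exists2 i, D i & g i z < inf [set g i z | i in D] + e.
  by move=> e0; have [_ [i Di <-]] := inf_adherent e0 (hi z); exists i.
have leZ a x : 0 < a ->
    inf [set g i (a *: x) | i in D] <= a * inf [set g i x | i in D].
  move=> a0; rewrite -ler_pdivrMl//; apply: lb_le_inf; first by case: (hi x).
  move=> _ [i Di <-]; rewrite ler_pdivrMl//.
  by have [k Dk] := gZ i a x Di a0; apply: le_trans; exact: infle.
split=> [x y|a x].
  apply/ler_addgt0Pr => e e0; have e20 : 0 < e / 2 by rewrite divr_gt0.
  have [i Di ix] := inflt x _ e20; have [j Dj jy] := inflt y _ e20.
  have [k Dk kxy] := gD i j x y Di Dj.
  have := infle k (x + y) Dk; lra.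
rewrite le_eqVlt => /predU1P[<-|a0].
  rewrite scale0r mul0r; apply/le_anti; rewrite (le_trans (infle i0 0 Di0))//=.
  by apply: lb_le_inf; [case: (hi 0)|move=> _ [i Di <-]; exact: g0].
apply/le_anti; rewrite leZ//= -ler_pdivlMl//.
rewrite -{1}[x](scalerK (lt0r_neq0 a0)).
by apply: leZ; rewrite invr_gt0.
Qed.

(** The infimum over t >= 0 of q(z + t p) - t q(p) works: subadditivity bounds it below by -q(-z), t
    = 0 shows that it is at most q, and t = 1 gives the bound at -p. *)
Lemma sublinear_shift q p : sublinear q ->
  exists r, [/\ sublinear r, forall z, r z <= q z & r (- p) <= - q p].
Proof.
move=> ql; have [qD qZ] := ql.
pose g t z := q (z + t *: p) - t * q p.
have glb z (t : R) : 0 <= t -> - q (- z) <= g t z.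
  move=> t0; rewrite /g -qZ// lerBrDr addrC lerBlDr addrC.
  by rewrite -{1}[t *: p](addKr z) (le_trans (qD _ _)).
have infle (t : R) z : 0 <= t -> inf [set g t z | t in [set t : R | 0 <= t]] <= g t z.
  move=> t0; apply: ge_inf; last by exists t.
  by exists (- q (- z)) => _ [u u0 <-]; exact: glb.
exists (fun z => inf [set g t z | t in [set t : R | 0 <= t]]); split.
- apply: inf_sublinear.
  + by move=> z; exists (- q (- z)) => t; exact: glb.
  + move=> s t x y s0 t0; exists (s + t); first exact: addr_ge0.
    have := qD (x + s *: p) (y + t *: p); rewrite addrACA -scalerDl /g; lra.
  + move=> t a x t0 a0; exists (a * t); first by rewrite /= mulr_ge0// ltW.
    by rewrite /g -scalerA -scalerDr (qZ _ _ (ltW a0)) mulrBr mulrA.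
  + by move=> t t0; rewrite (le_trans _ (glb 0 t t0))// oppr0 sublinear0 ?oppr0.
  + by exists 0 => //=; rewrite /g scale0r mul0r addr0 subr0 sublinear0.
- by move=> z; rewrite (le_trans (infle 0 z _))// /g scale0r mul0r addr0 subr0.
- by rewrite (le_trans (infle 1 (- p) _))// /g scale1r addNr sublinear0// mul1r sub0r.
Qed.

(** Zorn's lemma: every sublinear functional below q is at least -q(-z) at z, so chains have finite
    pointwise infima, which are again sublinear. *)
Lemma minimal_sublinear q : sublinear q -> exists r,
  [/\ sublinear r, forall z, r z <= q z &
    forall s, sublinear s -> (forall z, s z <= r z) -> s = r].
Proof.
move=> ql; pose T := {r : V -> R | sublinear r /\ forall z, r z <= q z}.
pose q0 : T := exist _ q (conj ql (fun z => lexx (q z))).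
(* The order is reversed, so that a maximal element is a minimal functional. *)
pose le : rel T := fun r s => `[< forall z, sval s z <= sval r z >].
have [||A Atot|[r [rl rq]] rmin] := @ZL_preorder T q0 le.
- by move=> r; apply/asboolP.
- move=> r s t /asboolP sr /asboolP rt; apply/asboolP => z.
  exact: le_trans (rt z) (sr z).
- have [[a0 Aa0]|A0] := pselect (A !=set0); last first.
    by exists q0 => s As; case: A0; exists s.
  pose i z := inf [set sval a z | a in A].
  have lb z (a : T) : - q (- z) <= sval a z.
    case: a => a [al aq] /=; rewrite (le_trans _ (sublinear_ge _ _ al))//.
    by rewrite lerN2.
  have ile a z : A a -> i z <= sval a z.
    by move=> Aa; apply: ge_inf; [exists (- q (- z)) => _ [b _ <-]|exists a].
  have il : sublinear i.
    apply: inf_sublinear.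
    + by move=> z; exists (- q (- z)) => a _; exact: lb.
    + move=> a b x y Aa Ab; have [/asboolP ab|/asboolP ba] := Atot a b Aa Ab.
        exists b => //; case: b ab {Ab} => b [[bD _] _] /= ab.
        by rewrite (le_trans (bD _ _))// lerD2r.
      exists a => //; case: a ba {Aa} => a [[aD _] _] /= ba.
      by rewrite (le_trans (aD _ _))// lerD2l.
    + move=> a t x Aa t0; exists a => //; case: a {Aa} => a [[_ aZ] _] /=.
      by rewrite aZ// ltW.
    + by move=> [a [al aq]] _ /=; rewrite sublinear0.
    + by exists a0 => //; case: a0 {Aa0} => a [al aq] /=; rewrite sublinear0.
  have iq z : i z <= q z by rewrite (le_trans (ile a0 z Aa0))//; case: (svalP a0).
  exists (exist _ i (conj il iq)) => s As; apply/asboolP => z /=; exact: ile.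
- exists r; split => // s sl sr; apply/funext => z; apply/le_anti; rewrite sr/=.
  have sq y : s y <= q y by exact: le_trans (sr y) (rq y).
  have /asboolP/(_ z) // := rmin (exist _ s (conj sl sq)) (introT (asboolP _) sr).
Qed.

(* A minimal sublinear functional is odd, hence linear: shifting it along any p
   cannot decrease it. *)
Theorem hahn_banach q p : sublinear q -> exists phi : V -> R^o,
  [/\ linear phi, forall z, phi z <= q z & phi p = q p].
Proof.
move=> ql; have [q' [q'l q'q q'p]] := sublinear_shift q p ql.
have [phi [phil phiq phimin]] := minimal_sublinear q' q'l.
have phiN z : phi (- z) = - phi z.
  have [r [rl rphi rz]] := sublinear_shift phi z phil.
  rewrite (phimin _ rl rphi) in rz.
  by apply/le_anti; rewrite rz/= lerNl sublinear_ge.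
have [phiD phiZ] := phil.
have phiD' x y : phi (x + y) = phi x + phi y.
  apply/le_anti; rewrite phiD/= -lerN2 opprD -!phiN opprD; exact: phiD.
exists phi; split.
- move=> a x y; rewrite phiD'; congr (_ + _).
  have [a0|a0] := leP 0 a; first exact: phiZ.
  have Na0 : 0 <= - a by rewrite oppr_ge0 ltW.
  by rewrite -[in LHS](opprK a) scaleNr phiN phiZ// mulNr opprK.
- by move=> z; exact: le_trans (phiq z) (q'q z).
- apply/le_anti; rewrite (le_trans (phiq p) (q'q p))/=.
  by rewrite -lerN2 -phiN (le_trans (phiq _)).
Qed.

End HahnBanach.

Lemma bounded_operator (R : realType) (Z V : normedModType R) (f : Z -> V)
    (c : R) : linear f -> (forall z, `|f z| <= c * `|z|) ->
  exists T : operator Z V, forall z, T z = f z.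
Proof.
move=> fl fc.
pose fL := HB.pack_for {linear Z -> V} f (GRing.isLinear.Build _ _ _ _ f fl).
have fcont : continuous f.
  apply: (@linear_bounded_continuous R Z V fL).1; apply/linear_boundedP.
  near=> r => z /=; have cr : c <= r by near: r; apply: nbhs_pinfty_ge; exact: num_real.
  by rewrite (le_trans (fc z))// ler_wpM2r.
by exists (Operator (introT (asboolP _) (conj fl fcont))).
Unshelve. all: by end_near. Qed.

(** Hahn-Banach applied to the distance to [M]: a linear functional below it vanishes on [M], is
    bounded by the norm, and can be made to equal the distance at [p]. *)
Lemma dual_separation (R : realType) (Z : normedModType R) (M : set Z) (p : Z) :
  M 0 -> (forall a u v, M u -> M v -> M (a *: u + v)) -> ~ closure M p ->
  exists2 phi : dual Z, (forall m, M m -> phi m = 0) & 0 < phi p.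
Proof.
move=> M0 ML Mp.
have MZ a u : M u -> M (a *: u) by move=> Mu; rewrite -[_ *: _]addr0; exact: ML.
pose q z := inf [set `|z - m| | m in M].
have infle m z : M m -> q z <= `|z - m|.
  by move=> Mm; apply: ge_inf; [exists 0 => _ [n _ <-]|exists m].
have ql : sublinear q.
  apply: inf_sublinear.
  - by move=> z; exists 0.
  - move=> m n x y Mm Mn; exists (m + n).
      by rewrite -[m]scale1r; exact: ML.
    by rewrite opprD addrACA ler_normD.
  - move=> m a x Mm a0; exists (a *: m); first exact: MZ.
    by rewrite -scalerBr normrZ gtr0_norm.
  - by [].
  - by exists 0; rewrite // subrr normr0.
have qM m : M m -> q m <= 0.
  by move=> Mm; rewrite (le_trans (infle m m Mm))// subrr normr0.
have [phi [phil phiq phip]] := hahn_banach q p ql.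
pose phiL := HB.pack_for {linear Z -> R^o} phi (GRing.isLinear.Build _ _ _ _ phi phil).
have phiN z : phi (- z) = - phi z := linearN phiL z.
have qx y : q y <= `|y| by rewrite -[y in `|y|]subr0; exact: infle.
have [|f fE] := bounded_operator R Z R^o phi 1 phil.
  move=> z; rewrite mul1r ler_norml lerNl -phiN -[X in (_ <= X) && _]normrN.
  by rewrite !(le_trans (phiq _)).
exists f => [m Mm|]; rewrite fE.
  apply/le_anti; rewrite (le_trans (phiq m) (qM m Mm))/= -lerN2 oppr0 -phiN.
  by rewrite (le_trans (phiq _))// qM// -scaleN1r; exact: MZ.
rewrite phip ltNge; apply/negP => qp.
apply: Mp; move=> B /nbhs_ballP[e /= e0 eB].
have hi : has_inf [set `|p - m| | m in M].
  by split; [exists `|p - 0|, 0|exists 0 => _ [n _ <-]].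
have [_ [m Mm <-] me] := inf_adherent e0 hi.
exists m; split => //; apply: eB; rewrite -ball_normE/=.
by rewrite (lt_le_trans me)// -/(q p) gerDr.
Qed.

(** * Countable generation, closure criteria and separability of subsets *)

(** Serves for closing under midpoints and under rational combinations; the last clause is the
    induction principle of the generated set. *)
Lemma countable_generated (I : countType) (T : Type) (op : I -> T -> T -> T)
    (A : set T) : countable A ->
  exists D : set T, [/\ countable D, A `<=` D,
    forall i u v, D u -> D v -> D (op i u v) &
    forall P : set T, A `<=` P ->
      (forall i u v, P u -> P v -> P (op i u v)) -> D `<=` P].
Proof.
move=> cA; pose step (E : set T) :=
  E `|` [set op k.1 k.2.1 k.2.2 | k in [set: I] `*` (E `*` E)].
have cstep n : countable (iter n step A).
  elim: n => [//|n IHn] /=; rewrite /step.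
  rewrite -bigcup2E; apply: bigcup_countable => // -[|[|k]] _ //=.
  apply: sub_countable (card_image_le _ _) _.
  by do 2?apply: countableX => //; exact: countableP.
have mono m n : (m <= n)%N -> iter m step A `<=` iter n step A.
  move=> /subnK <-; elim: (n - m)%N => [//|k IHk] x /IHk; by left.
exists (\bigcup_n iter n step A); split.
- exact: bigcup_countable.
- by move=> x Ax; exists 0%N.
- move=> i u v [m _ mu] [n _ nv]; exists (maxn m n).+1 => //; right.
  by exists (i, (u, v)) => //; split => //; split => /=;
    [apply: (mono m)|apply: (mono n)]; rewrite ?leq_maxl ?leq_maxr.
- move=> P AP Pop x [n _]; elim: n x => [|n IHn] x /=; first exact: AP.
  by move=> [/IHn//|[[i [u v]] /= [_ [/IHn Pu /IHn Pv]] <-]]; exact: Pop.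
Qed.

Lemma closure_weak_starP (R : realType) (Y : normedModType R)
    (A : set (dual Y)) (p : dual Y) :
  closure (A : set (weak_star Y)) p <->
  forall (s : seq Y) (e : R), 0 < e ->
    exists2 q, A q & forall y, y \in s -> `|p y - q y| < e.
Proof. exact: (@closure_pointwiseP R (dual Y) Y R^o). Qed.

Lemma closure_weakP (R : realType) (Z : normedModType R) (A : set Z) (p : Z) :
  closure (A : set (weak Z)) p <->
  forall (s : seq (dual Z)) (e : R), 0 < e ->
    exists2 q, A q & forall phi : dual Z, phi \in s -> `|phi p - phi q| < e.
Proof. exact: (@closure_pointwiseP R Z (dual Z) R^o). Qed.

Lemma closure_sotP (R : realType) (X Z : normedModType R)
    (A : set (operator X Z)) (p : operator X Z) :
  closure (A : set (sot X Z)) p <->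
  forall (s : seq X) (e : R), 0 < e ->
    exists2 q, A q & forall x, x \in s -> `|p x - q x| < e.
Proof. exact: (@closure_pointwiseP R (operator X Z) X Z). Qed.

Lemma separable_subset (R : realType) (V : normedModType R) (A B : set V) :
  separable_set A -> B `<=` A -> separable_set B.
Proof.
move=> [D [cD _ AD]] BA.
(* [h] picks a point of [B] within 1/(n+1) of d if there is one, and 0 otherwise; intersecting with
   [B] below removes defaults outside [B]. *)
have /choice[h hP] (dn : V * nat) : exists b,
    (exists b', B b' /\ `|dn.1 - b'| < dn.2.+1%:R^-1) ->
    B b /\ `|dn.1 - b| < dn.2.+1%:R^-1.
  by have [[b bP]|?] := pselect (exists b', B b' /\ `|dn.1 - b'| < dn.2.+1%:R^-1);
    [exists b|exists 0].
exists (h @` (D `*` [set: nat]) `&` B); split.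
- apply: sub_countable (subset_card_le (@subIsetl _ _ _)) _.
  apply: sub_countable (card_image_le _ _) _.
  by apply: countableX => //; exact: countableP.
- exact: subIsetr.
- move=> b Bb U /nbhs_ballP[e /= e0 eU].
  have [n _ ne] := near_infty_natSinv_lt (PosNum (divr_gt0 e0 (ltr0n _ 2))).
  have {}ne : n.+1%:R^-1 < e / 2 by exact: (ne n (leqnn n)).
  have n0 : 0 < n.+1%:R^-1 :> R by rewrite invr_gt0.
  have [d [Dd]] := AD b (BA b Bb) (ball b n.+1%:R^-1) (nbhsx_ballx _ _ n0).
  rewrite -ball_normE/= distrC => db.
  have [|Bh dh] := hP (d, n); first by exists b.
  exists (h (d, n)); split; first by split => //; exists (d, n).
  apply: eU; rewrite -ball_normE/= -(subrKA d) (le_lt_trans (ler_normD _ _))//.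
  rewrite [e]splitr ltrD//; [rewrite distrC|]; exact: lt_trans ne.
Qed.

(** * Weak* separation from midpoint-closed sets *)

Lemma exists_dyadic_le (R : realType) (K e : R) : 0 < e ->
  exists n, 2^-1 ^+ n * K <= e.
Proof.
move=> e0; have [n Kn] : exists n, K / e <= n%:R.
  by exists (Num.truncn `|K / e|).+1; rewrite (le_trans (ler_norm _))// ltW// truncnS_gt.
exists n; rewrite exprVn mulrC ler_pdivrMr ?exprn_gt0//.
rewrite -ler_pdivrMl// mulrC (le_trans Kn)// -natrX ler_nat ltnW//.
exact: ltn_expl.
Qed.

(* For a nearly closest point w0 of W to p, in the Euclidean seminorm given by
   finitely many evaluations, p - w0 almost separates W from p; comparing w0
   with its dyadic convex combinations with the points of W only uses that W is
   closed under midpoints. *)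
Lemma weak_star_separation (R : realType) (Y : normedModType R)
    (W : set (dual Y)) (p : dual Y) (M : R) :
  W !=set0 -> (forall u v, W u -> W v -> W (2^-1 *: (u + v))) ->
  (forall w y, W w -> `|w y| <= M * `|y|) ->
  ~ closure (W : set (weak_star Y)) p ->
  exists y, forall w, W w -> w y <= p y - 1.
Proof.
move=> [w1 Ww1] Wmid WM Wp.
have [s [e e0 sW]] : exists s : seq Y, exists2 e : R, 0 < e &
    forall w, W w -> exists2 u, u \in s & e <= `|p u - w u|.
  apply: contrapT => no; apply: Wp; apply/closure_weak_starP => s e e0.
  apply: contrapT => no2; apply: no; exists s, e => // w Ww.
  apply: contrapT => no3; apply: no2; exists w => // u us.
  by rewrite ltNge; apply/negP => ?; apply: no3; exists u.
pose N (w : dual Y) : R := \sum_(u <- s) (p u - w u) ^+ 2.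
have Ne w : W w -> e ^+ 2 <= N w.
  move=> /sW[u us eu]; rewrite /N (big_rem u)//= -[leLHS]addr0 lerD//.
    by rewrite -(real_normK (num_real (p u - w u))) lerXn2r ?nnegrE// (ltW e0).
  by apply: sumr_ge0 => v _; rewrite sqr_ge0.
(* [K] bounds the squared seminorm of w - w0 for all w, w0 in [W]; it fixes the dyadic step [t]
   before [w0] is chosen. *)
pose K : R := \sum_(u <- s) (M * `|u| + M * `|u|) ^+ 2.
have e20 : 0 < e ^+ 2 / 2 by rewrite divr_gt0 ?exprn_gt0.
have [n nK] := exists_dyadic_le R K _ e20.
set t : R := 2^-1 ^+ n in nK.
have t0 : 0 < t by rewrite exprn_gt0 ?invr_gt0.
have hN : has_inf (N @` W).
  split; first by exists (N w1), w1.
  by exists 0 => _ [w _ <-]; apply: sumr_ge0 => u _; rewrite sqr_ge0.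
have te0 : 0 < t * (e ^+ 2 / 2) by rewrite mulr_gt0.
have [_ [w0 Ww0 <-] w0inf] := inf_adherent te0 hN.
have Wt w : W w -> W (w0 + t *: (w - w0)).
  move=> Ww; rewrite /t; elim: (n) => [|m IHm].
    by rewrite expr0 scale1r addrC subrK.
  have := Wmid _ _ Ww0 IHm; rewrite addrA -mulr2n scalerDr -[w0 *+ 2]scaler_nat.
  by rewrite !scalerA mulVf ?pnatr_eq0// scale1r -exprS.
pose ip w : R := \sum_(u <- s) (p u - w0 u) * (w u - w0 u).
(* Expanding [N] at w0 + t(w - w0) and using that [w0] is nearly minimal gives 2 ip(w) <= e^2/2 + t
   Q <= e^2. *)
have ipt w : W w -> ip w <= e ^+ 2 / 2.
  move=> Ww; pose Q : R := \sum_(u <- s) (w u - w0 u) ^+ 2.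
  have QK : Q <= K.
    apply: ler_sum => u _.
    rewrite -(real_normK (num_real (w u - w0 u))) lerXn2r ?nnegrE//.
      by rewrite addr_ge0// (le_trans _ (WM _ u Ww0)).
    by rewrite (le_trans (ler_normB _ _))// lerD// WM.
  have NE : N (w0 + t *: (w - w0)) = N w0 - 2 * t * ip w + t ^+ 2 * Q.
    rewrite /N /ip /Q !mulr_sumr -sumrB -big_split /=; apply: eq_bigr => u _.
    transitivity ((p u - (w0 u + t * (w u - w0 u))) ^+ 2); [by []|ring].
  have inft : inf (N @` W) <= N (w0 + t *: (w - w0)).
    by apply: ge_inf; [case: hN|exists (w0 + t *: (w - w0)) => //; exact: Wt].
  rewrite NE in inft.
  have tQ : t * (t * Q) <= t * (e ^+ 2 / 2).
    by rewrite ler_pM2l// (le_trans _ nK)// ler_pM2l.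
  rewrite -(ler_pM2l t0); rewrite expr2 in inft; lra.
exists ((2 / e ^+ 2) *: \sum_(u <- s) (p u - w0 u) *: u) => w Ww.
have yE (f : dual Y) : f ((2 / e ^+ 2) *: \sum_(u <- s) (p u - w0 u) *: u) =
    2 / e ^+ 2 * \sum_(u <- s) (p u - w0 u) * f u.
  rewrite linearZ linear_sum /=; congr (_ * _); apply: eq_bigr => u _.
  by rewrite linearZ.
have wp : \sum_(u <- s) (p u - w0 u) * w u <=
    \sum_(u <- s) (p u - w0 u) * p u - e ^+ 2 / 2.
  have : ip w - N w0 = \sum_(u <- s) (p u - w0 u) * w u -
      \sum_(u <- s) (p u - w0 u) * p u.
    by rewrite -!sumrB; apply: eq_bigr => u _; ring.
  have := ipt w Ww; have := Ne w0 Ww0; lra.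
have e2 : 0 <= 2 / e ^+ 2 by rewrite divr_ge0 ?exprn_ge0// ltW.
rewrite !yE (le_trans (ler_wpM2l e2 wp))// mulrBr.
by rewrite (_ : 2 / e ^+ 2 * (e ^+ 2 / 2) = 1)//; field; rewrite gt_eqF.
Qed.

(** * Bilinear forms on tensors and property (C) *)

Section TensorForms.
Context {R : realType} {X Y : normedModType R}.
Implicit Types (B : {bilinear X -> Y -> R^o}) (u : tensor X Y).

Lemma tensor_val_sum (s : seq (X * Y)) B :
  tensor_val (\sum_(p <- s) pure_tensor p.1 p.2) B = \sum_(p <- s) B p.1 p.2.
Proof.
rewrite -[tensor_val _]/(val _) raddf_sum /= fct_sumE.
by apply: eq_bigr.
Qed.

Lemma tensor_valB u v B : tensor_val (u - v) B = tensor_val u B - tensor_val v B.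
Proof. by rewrite -[tensor_val _]/(val _) raddfB. Qed.

Lemma tensor_val_bound B (c : R) u : 0 <= c ->
  (forall x y, `|B x y| <= c * (`|x| * `|y|)) ->
  `|tensor_val u B| <= c * projective_norm u.
Proof.
move=> c0 Bc; apply/ler_addgt0Pr => e e0.
have c1 : 0 < c + 1 by rewrite ltr_wpDl.
have [s us se] := projective_norm_lt u (divr_gt0 e0 c1).
rewrite [in leLHS]us tensor_val_sum (le_trans (ler_norm_sum _ _ _))//.
rewrite (@le_trans _ _ (c * \sum_(p <- s) `|p.1| * `|p.2|))//.
  by rewrite mulr_sumr; apply: ler_sum => p _; exact: Bc.
rewrite (le_trans (ler_wpM2l c0 (ltW se)))// mulrDr lerD2l mulrA ler_pdivrMr//.
by rewrite mulrC ler_wpM2l ?(ltW e0)// lerDl.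
Qed.

(** Each condition defines a closed convex set, and the countable case makes countable intersections
    nonempty, so property (C) gives a common point. Replacing it by a nearby algebraic tensor
    weakens -1 to -1/2. *)
Lemma tensor_selection {I : Type} (A : set I) (B : I -> {bilinear X -> Y -> R^o})
    (c : R) : property_C (projective_tensor X Y) -> 0 <= c ->
  (forall i x y, A i -> `|B i x y| <= c * (`|x| * `|y|)) ->
  (forall J : set I, countable J -> J `<=` A ->
    exists u, forall i, J i -> tensor_val u (B i) <= - 1) ->
  exists u, forall i, A i -> tensor_val u (B i) <= - 2^-1.
Proof.
move=> hC c0 Bc countable_case.
have [[i0 Ai0]|A0] := pselect (A !=set0); last first.
  by exists 0 => i Ai; case: A0; exists i.
pose emb : tensor X Y -> projective_tensor X Y :=
  completion_embed (projective_seminorm X Y).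
have embB u v : `|emb u - emb v| = projective_norm (u - v).
  by rewrite -linearB completion_embed_norm.
(* Working with closures of sets of algebraic tensors avoids extending the forms
   B i to the completion. *)
pose K i : set (projective_tensor X Y) :=
  closure (emb @` [set u | tensor_val u (B i) <= - 1]).
have Kconvex i : convex_set (K i).
  apply/convex_setW => x y /[!inE] Kx Ky k k0 k1; rewrite inE.
  have {}k1 : 0 < (1 - k%:num) by rewrite subr_gt0.
  move=> U /nbhs_ballP[e /= e0 eU].
  have [_ [[u /= uB <-] xu]] := Kx (ball x e) (nbhsx_ballx _ _ e0).
  have [_ [[v /= vB <-] yv]] := Ky (ball y e) (nbhsx_ballx _ _ e0).
  rewrite -!ball_normE/= in xu yv.
  exists (emb (k%:num *: u + (1 - k%:num) *: v)); split.
    eexists; last reflexivity.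
    rewrite /= -[X in X <= _]/(k%:num * tensor_val u (B i) +
      (1 - k%:num) * tensor_val v (B i)); nra.
  apply: eU; rewrite -ball_normE/= /emb linearD !linearZ /=.
  rewrite [X in `|X|](_ : _ = k%:num *: (x - emb u) + (1 - k%:num) *: (y - emb v)).
    rewrite (le_lt_trans (ler_normD _ _))// !normrZ !gtr0_norm//; nra.
  by rewrite !scalerBr opprD addrACA.
have [[z Kz]|K0] := pselect (\bigcap_(i in A) K i !=set0).
  (* Two tensors within [e] of [z] differ by at most 2e in norm, so each form changes by at most 2ce
     <= 1/2; the 1 covers c = 0. *)
  pose e := (4 * (c + 1))^-1.
  have e0 : 0 < e by rewrite invr_gt0 mulr_gt0// ltr_wpDl.
  have ce : c * (e + e) <= 2^-1.
    have : (4 * (c + 1)) * e = 1 by rewrite divff// gt_eqF// mulr_gt0// ltr_wpDl.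
    nra.
  have : closure (range emb) z by rewrite completion_embed_dense.
  move=> /(_ (ball z e) (nbhsx_ballx _ _ e0))[_ [[u _ <-] zu]].
  exists u => i Ai.
  have [_ [[v /= vB <-] zv]] := Kz i Ai (ball z e) (nbhsx_ballx _ _ e0).
  rewrite -!ball_normE/= in zu zv.
  have uv : projective_norm (u - v) <= e + e.
    rewrite -embB -(subrKA z) (le_trans (ler_normD _ _))// lerD//.
      by rewrite distrC ltW.
    exact: ltW.
  have := tensor_val_bound (B i) c (u - v) c0 (fun x y => Bc i x y Ai).
  rewrite tensor_valB ler_norml => /andP[_].
  have := ler_wpM2l c0 uv; lra.
exfalso; have [||G [GK cG G0]] := hC (K @` A).
- by move=> _ [i _ <-]; split; [exact: Kconvex|exact: closed_closure].
- apply/eqP/negPn/negP => /set0P[z Kz]; apply: K0; exists z => i Ai.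
  by apply: Kz; exists i.
have /choice[h hP] (C : set (projective_tensor X Y)) :
    exists i, G C -> A i /\ K i = C.
  by have [/GK[i Ai KC]|] := pselect (G C); [exists i|exists i0].
have [||u uP] := countable_case (h @` G).
- exact: sub_countable (card_image_le _ _) cG.
- by move=> _ [C /hP[AC _] <-].
suff : (\bigcap_(C in G) C) (emb u) by rewrite G0.
move=> C GC; have [_ <-] := hP C GC; apply: subset_closure; exists u => //=.
by apply: uP; exists C.
Qed.

End TensorForms.

(** * A countable set with weak* dense image *)

Section CountableDensity.
Context {R : realType} {X Y : completeNormedModType R} (T : operator X (dual Y)).

Lemma dual_operator_bound x y : `|T x y| <= opnorm T * (`|x| * `|y|).
Proof.
rewrite mulrA (le_trans (opnorm_bound (T x) y))// ler_wpM2r//.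
exact: (opnorm_bound T x).
Qed.

(** The bilinear form of T o S - T, written through S x - x so that closeness of S to the identity
    bounds it directly. *)
Definition defect (S : operator X X) (x : X) (y : Y) : R^o := T (S x - x) y.

Fact defect_bilinear S : bilinear_for *:%R *:%R (defect S).
Proof.
split=> [y a x1 x2|x a y1 y2]; rewrite /defect; last by rewrite linearP.
by rewrite linearP opprD addrACA -scalerBr linearP.
Qed.

HB.instance Definition _ S :=
  bilinear_isBilinear.Build R X Y R^o _ _ (defect S) (defect_bilinear S).

(* The operators S of the approximation property make the functionals
   T o S - T on the projective tensor product cluster at 0, so no single tensor
   keeps all of them away from 0. By property (C) some countable family J of
   such S cannot be kept away from 0 either, and the wanted set is a countable
   midpoint-closed set whose closure contains their ranges. *)
Lemma countable_weak_star_dense (lambda : R) :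
  property_C (projective_tensor X Y) -> 0 <= lambda -> BSAP lambda X ->
  exists D : set X, [/\ countable D, D `<=` unit_ball X &
    forall x, lambda * `|x| <= 1 ->
      closure (T @` D : set (weak_star Y)) (T x)].
Proof.
move=> hC l0 hX; apply: contrapT => noD.
set A := [set lambda *: S | S in unit_ball (operator X X)]
  `&` @separable_operators R X X in hX *.
have AE S x : A S -> `|S x| <= lambda * `|x|.
  move=> [[S' S1 <-] _]; rewrite operatorZE normrZ ger0_norm// ler_wpM2l//.
  by rewrite (le_trans (opnorm_bound S' x))// ler_piMl.
pose c := opnorm T * (lambda + 1).
have T0 : 0 <= opnorm T by rewrite (le_trans _ (opnorm_ub T _ (x := 0)))// normr0.
have c0 : 0 <= c by rewrite mulr_ge0// addr_ge0.
have [| |u uA] := tensor_selection A (fun S => defect S) c hC c0.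
- move=> S x y AS; rewrite (le_trans (dual_operator_bound _ _))// /c -mulrA.
  rewrite ler_wpM2l// mulrA ler_wpM2r// (le_trans (ler_normB _ _))// mulrDl mul1r.
  by rewrite lerD2r AE.
(* Every S in [J] maps [B] into the unit ball. So [D], generated under midpoints by 0 and countable
   dense parts of the sets S(B), stays in the unit ball, and [noD] yields a bad point x of [B]. *)
- move=> J cJ JA; pose B := [set x : X | lambda * `|x| <= 1].
  have /choice[E EP] (S : operator X X) : exists E : set X, J S ->
      [/\ countable E, E `<=` S @` B & S @` B `<=` closure E].
    have [/JA[_ Ssep]|] := pselect (J S); last by exists set0.
    have [|E] := separable_subset R X _ (S @` B) Ssep; last by exists E.
    by move=> _ [x _ <-]; exists x.
  have cE : countable ([set 0 : X] `|` \bigcup_(S in J) E S).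
    rewrite -bigcup2E; apply: bigcup_countable => // -[|[|k]] _ //=.
    by apply: bigcup_countable => // S /EP[].
  have [D [cD ED Dmid Dmin]] := @countable_generated unit X
    (fun _ u v => 2^-1 *: (u + v)) _ cE.
  have D1 : D `<=` unit_ball X.
    apply: Dmin; rewrite /unit_ball.
      move=> x [->|[S JS ESx]] /=; first by rewrite normr0.
      have [_ /(_ x ESx)[z Bz <-] _] := EP S JS.
      exact: le_trans (AE S z (JA S JS)) Bz.
    move=> _ x y /= x1 y1; rewrite normrZ gtr0_norm ?invr_gt0//.
    have := ler_normD x y; lra.
  have [x [x1 Tx]] : exists x, lambda * `|x| <= 1 /\
      ~ closure (T @` D : set (weak_star Y)) (T x).
    apply: contrapT => nox; apply: noD; exists D; split => // x x1.
    by apply: contrapT => Tx; apply: nox; exists x.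
  (* The inequality T z y <= T x y - 1 on [D] passes to z = S x by norm density, so the pure tensor
     of x and y brings every defect in [J] down to -1. *)
  have [|||y yP] := weak_star_separation R Y (T @` D) (T x) (opnorm T) _ _ _ Tx.
  + by exists (T 0), 0 => //; apply: ED; left.
  + move=> _ _ [u Du <-] [v Dv <-]; exists (2^-1 *: (u + v)); first exact: (Dmid tt).
    by rewrite linearZ linearD.
  + move=> _ y [u /D1 u1 <-]; rewrite (le_trans (dual_operator_bound _ _))//.
    by rewrite ler_wpM2l// ler_piMl.
  exists (pure_tensor x y) => S JS.
  rewrite -[tensor_val _ _]/(T (S x - x) y) linearB.
  rewrite -[_ y]/(T (S x) y - T x y).
  suff : T (S x) y <= T x y - 1 by lra.
  have [_ _ SE] := EP S JS.
  have SxE : closure (E S) (S x) by apply: SE; exists x.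
  apply/ler_addgt0Pr => e e0.
  have k0 : 0 < opnorm T * `|y| + 1 by rewrite ltr_wpDl// mulr_ge0.
  have ek0 : 0 < e / (opnorm T * `|y| + 1) by rewrite divr_gt0.
  have [z [Ez]] := SxE _ (nbhsx_ballx _ _ ek0); rewrite -ball_normE/= => Sxz.
  have zy : T z y <= T x y - 1.
    by apply: yP; exists z => //; apply: ED; right; exists S.
  have : T (S x) y - T z y <= e.
    rewrite -[leLHS]/((T (S x) - T z) y) -linearB (le_trans (ler_norm _))//.
    rewrite (le_trans (dual_operator_bound _ _))// mulrCA.
    rewrite -[e](divfK (lt0r_neq0 k0)) ler_pM ?mulr_ge0//; first exact: ltW.
    by rewrite lerDl.
  lra.
(* The tensor involves finitely many x, and the approximation property gives S in [A] so close to
   the identity on them that the defect of S at [u] is below 1/2 in absolute value, a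
   contradiction. *)
- have [s us] := tensorP u; pose k := opnorm T * \sum_(p <- s) `|p.2|.
  have k0 : 0 <= k by rewrite mulr_ge0// sumr_ge0.
  have k1 : 0 < k + 1 by rewrite ltr_wpDl.
  have e0 : 0 < 2^-1 / (k + 1) by rewrite divr_gt0 ?invr_gt0.
  have [S AS Ss] := (closure_sotP _ _ _ _ _).1 hX [seq p.1 | p <- s] _ e0.
  have := uA S AS; apply/negP; rewrite -ltNge us tensor_val_sum /=.
  rewrite ltrNl (le_lt_trans (ler_norm _))// normrN.
  rewrite (le_lt_trans (ler_norm_sum _ _ _))//.
  rewrite (@le_lt_trans _ _ (2^-1 / (k + 1) * k))//.
    rewrite /k mulrCA mulr_sumr mulr_sumr [leRHS]big_seq [leLHS]big_seq.
    apply: ler_sum => p ps; rewrite (le_trans (dual_operator_bound _ _))//.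
    rewrite ler_wpM2l// ler_wpM2r// distrC ltW// Ss//.
    by apply/mapP; exists p.
  by rewrite mulrAC ltr_pdivrMr// ltr_pM2l ?invr_gt0// ltrDl.
Qed.

End CountableDensity.

(** * From weak* closures to weak and norm closures *)

(** By compactness, the trace on [A] of the weak* neighbourhoods of [p] clusters weakly at some q.
    Evaluations at points of [Y] are weakly continuous, so q = p. *)
Lemma closure_weak_star_weak (R : realType) (Y : normedModType R)
    (K A : set (dual Y)) (p : dual Y) :
  compact (closure (K : set (weak (dual Y)))) -> A `<=` K ->
  closure (A : set (weak_star Y)) p -> closure (A : set (weak (dual Y))) p.
Proof.
move=> Kc AK Ap; pose F := within A (nbhs (p : weak_star Y)).
have FF : ProperFilter F by exact: (@within_nbhs_proper (weak_star Y) A p Ap).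
have FA : F A by exact: withinT.
have [|q [_ Fq]] := Kc F FF.
  by apply: filterS FA => a /AK; exact: subset_closure.
suff -> : p = q by move=> U; exact: Fq.
apply: operatorP => y; apply: contrapT => /eqP pq.
have e0 : 0 < `|p y - q y| / 2 by rewrite divr_gt0// normr_gt0 subr_eq0.
have [||ev evE] := bounded_operator R (dual Y) R^o (fun phi => phi y) `|y|.
- by [].
- by move=> phi; rewrite mulrC; exact: (opnorm_bound phi y).
have Fp : F [set phi | `|p y - phi y| < `|p y - q y| / 2].
  apply: (@filterS _ (nbhs (p : weak_star Y)) _ _ _ _
    (@nbhs_pointwise_ball R (dual Y) Y R^o (fun phi : dual Y => phi : Y -> R)
      p [:: y] _ e0)).
  by move=> phi + _; apply; rewrite inE.
have Wq := @nbhs_pointwise_ball R (dual Y) (dual (dual Y)) R^o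
  (fun z phi => phi z) q [:: ev] _ e0.
have [phi [/= py /(_ ev)]] := Fq _ _ Fp Wq.
rewrite inE eqxx !evE => /(_ isT) qy.
have := ler_normD (p y - phi y) (phi y - q y).
by rewrite addrA subrK [`|phi y - _|]distrC; lra.
Qed.

(** A functional vanishing on [M] and positive at [p] would define a weak neighbourhood of [p]
    missing [M]. *)
Lemma closure_weak_subspace (R : realType) (Z : normedModType R) (M : set Z)
    (p : Z) :
  M 0 -> (forall a u v, M u -> M v -> M (a *: u + v)) ->
  closure (M : set (weak Z)) p -> closure M p.
Proof.
move=> M0 ML Mp; apply: contrapT => /(dual_separation _ _ _ _ M0 ML)[phi phiM phip].
have [m Mm /(_ phi)] := (closure_weakP _ _ _ _).1 Mp [:: phi] _ phip.
by rewrite inE eqxx (phiM m Mm) subr0 gtr0_norm// ltxx => /(_ isT).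
Qed.

Lemma closure_rat_subspace (R : realType) (V : normedModType R) (M : set V) :
  (forall (k : rat) u v, M u -> M v -> M (ratr k *: u + v)) ->
  forall (a : R) u v, closure M u -> closure M v -> closure M (a *: u + v).
Proof.
move=> ML a u v Mu Mv U /nbhs_ballP[e /= e0 eU].
have e3 : 0 < e / 3 by rewrite divr_gt0.
have u1 : 0 < `|u| + 1 by rewrite ltr_wpDl.
have a1 : 0 < `|a| + 1 by rewrite ltr_wpDl.
(* The bound 1 keeps |k| <= |a| + 1; the other one makes (a - k) u at most e/3. *)
have d0 : 0 < Num.min 1 (e / 3 / (`|u| + 1)) by rewrite lt_min ltr01 divr_gt0.
have [|k] := @rat_in_itvoo R a (a + Num.min 1 (e / 3 / (`|u| + 1))).
  by rewrite ltrDl.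
rewrite in_itv/= -ltrBlDl lt_min => /andP[ak /andP[ka1 kae]].
have ek0 : 0 < e / 3 / (`|a| + 1) by rewrite divr_gt0.
have [u' [Mu']] := Mu _ (nbhsx_ballx _ _ ek0).
have [v' [Mv']] := Mv _ (nbhsx_ballx _ _ e3).
rewrite -!ball_normE/= => vv' uu'.
exists (ratr k *: u' + v'); split; first exact: ML.
apply: eU; rewrite -ball_normE/=.
have -> : a *: u + v - (ratr k *: u' + v') =
    (a - ratr k) *: u + ratr k *: (u - u') + (v - v').
  by rewrite scalerBl scalerBr subrKA opprD addrACA.
rewrite (le_lt_trans (ler_normD _ _))//.
have -> : e = e / 3 + e / 3 + e / 3 by field.
rewrite ler_ltD// (le_trans (ler_normD _ _))// (normrZ (a - _)) (normrZ (ratr k)) lerD//.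
  rewrite distrC gtr0_norm ?subr_gt0// -[leRHS](divfK (lt0r_neq0 u1)).
  by rewrite ler_pM// ?subr_ge0 ?(ltW ak) ?(ltW kae)// lerDl.
have rk : `|ratr k : R| <= `|a| + 1.
  have := ler_normD a (ratr k - a); rewrite (addrC a) subrK.
  by rewrite [`|ratr k - a|]gtr0_norm ?subr_gt0//; lra.
rewrite (le_trans (ler_pM _ _ rk (ltW uu')))// mulrC divfK//; exact: lt0r_neq0.
Qed.

(** * Derivation of the three statements *)

Theorem corollary3p11 (R : realType) (X Y : completeNormedModType R)
    (lambda : R) (hC : property_C (projective_tensor X Y))
    (hlambda : 1 <= lambda) (hX : BSAP lambda X) :
  [/\ (forall T : operator X (dual Y), has_weak_star_separable_range T),
      weakly_compact_operators X (dual Y) `<=` separable_operators X (dual Y)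
    & lambda = 1 ->
      [set: operator X (dual Y)] = weak_star_separable_operators X Y].
Proof.
have l0 : 0 < lambda by exact: lt_le_trans hlambda.
have key (T : operator X (dual Y)) := countable_weak_star_dense T lambda hC (ltW l0) hX.
(* [key] only covers lambda |x| <= 1. Dividing by an integer lets the later multiplication by n stay
   in a rational span. *)
have scale (x : X) : exists2 n : nat, (0 < n)%N & lambda * `|n%:R^-1 *: x| <= 1.
  exists (Num.truncn (lambda * `|x|)).+1 => //.
  rewrite normrZ gtr0_norm ?invr_gt0// mulrCA ler_pdivrMl// mulr1 ltW//.
  exact: truncnS_gt.
have span (T : operator X (dual Y)) (D : set X) : countable D ->
    exists M : set X, [/\ countable (T @` M), M 0, D `<=` M &
      forall (k : rat) u v, M u -> M v -> M (ratr k *: u + v)].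
  move=> cD; have cD0 : countable ([set 0 : X] `|` D).
    by rewrite -bigcup2E; apply: bigcup_countable => // -[|[|k]] _ /=.
  have [M [cM DM ML _]] := @countable_generated rat X
    (fun k u v => ratr k *: u + v) _ cD0.
  exists M; split => //; first exact: sub_countable (card_image_le _ _) cM.
    by apply: DM; left.
  by move=> x Dx; apply: DM; right.
split.
- move=> T; have [D [cD _ DT]] := key T; have [M [cM M0 DM ML]] := span T D cD.
  exists (T @` M); split => //; first by move=> _ [u _ <-]; exists u.
  move=> _ [x _ <-]; have [n n0 /DT nx] := scale x.
  apply/closure_weak_starP => s e e0.
  (* Multiplying back by n multiplies the error by n. *)
  have en0 : 0 < e / n%:R by rewrite divr_gt0// ltr0n.
  have [_ [u Du <-] us] := (closure_weak_starP _ _ _ _).1 nx s _ en0.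
  exists (T (ratr n%:R *: u + 0)).
    by exists (ratr n%:R *: u + 0) => //; apply: ML => //; exact: DM.
  move=> y ys; have := us y ys; rewrite addr0 ratr_nat ltr_pdivlMr ?ltr0n//.
  have TZ (a : R) v : T (a *: v) y = a * T v y by rewrite linearZ.
  rewrite !TZ -[X in _ * X < _](ger0_norm (ler0n R n)) -normrM mulrC mulrBr mulVKf//.
  by rewrite pnatr_eq0 -lt0n.
- move=> T Tc; have [D [cD D1 DT]] := key T; have [M [cM M0 DM ML]] := span T D cD.
  exists (T @` M); split => //; first by move=> _ [u _ <-]; exists u.
  have NL : forall (a : R) u v, closure (T @` M) u -> closure (T @` M) v ->
      closure (T @` M) (a *: u + v).
    apply: closure_rat_subspace => k _ _ [u Mu <-] [v Mv <-].
    by exists (ratr k *: u + v); [exact: ML|rewrite linearP].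
  have N0 : closure (T @` M) 0.
    by apply: subset_closure; exists 0 => //; rewrite linear0.
  move=> _ [x _ <-]; have [n n0 /DT nx] := scale x.
  have -> : T x = n%:R *: T (n%:R^-1 *: x) + 0.
    by rewrite addr0 -linearZ scalerA divff ?scale1r// pnatr_eq0 -lt0n.
  (* T(M) is only known to be closed under rational combinations, so the passage from weak to norm
     closure is made for its norm closure, a closed real subspace. *)
  apply: (NL) => //; apply: (@closed_closure _ (T @` M)).
  apply: (closure_weak_subspace _ _ _ _ N0 NL).
  have DK : T @` D `<=` T @` unit_ball X by move=> _ [u /D1 u1 <-]; exists u.
  have := closure_weak_star_weak _ _ _ _ _ Tc DK nx.
  apply: closure_subset => _ [u /DM Mu <-]; apply: subset_closure; exists u => //.
- move=> l1; apply/esym/seteqP; split => // T _.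
  have [D [cD D1 DT]] := key T; exists (T @` D); split.
  + exact: sub_countable (card_image_le _ _) cD.
  + by move=> _ [u /D1 u1 <-]; exists u.
  + by move=> _ [x x1 <-]; apply: DT; rewrite l1 mul1r.
Qed.
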